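(* If the vorticity is given by $$\zeta=\frac{(f_1')^2}{z_2f_1''+f_2'},$$ where $f_1=f_1(z_1)$ and $f_2=f_2(z_1)$ are functions of one variable, then $$\zeta=\frac{1}{g_1(z_1)+z_2\,g_2(z_1)},$$ where the functions $g_1,g_2$ of one variable are arbitrary.
   Context: Primes denote derivatives of functions of one variable, and $z=(z_1,z_2)$ are coordinates in a domain of $\mathbb{R}^2$. The first formula is the expression stated for the vorticity $\zeta$, in the label coordinates $z$, of the two-dimensional incompressible Euler flow $\varphi(z,t)=A(t)v(z)$ with $A=\begin{pmatrix} t&1&0&0\\ 0&0&1&t\end{pmatrix}$ and $v=\big(z_1,\;z_2,\;z_2f_1'(z_1)+f_2(z_1),\;f_1(z_1)\big)$, where $z_2f_1''+f_2'\neq0$.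
   Formalization: The form 1/(g1+z2 g2) is asserted only where f1' ≠ 0 (elsewhere ζ = 0), and ''arbitrary'' is read locally: every nonvanishing g1+z2 g2 with continuous g1, g2 is realized on each strip a<z1<b with a, b in the projection of the domain, not on the whole domain. *)

(* Defs.v *)
From HB Require Import structures.
From mathcomp Require Import all_boot all_order all_algebra.
From mathcomp Require Import all_classical all_reals all_analysis.
Set Implicit Arguments.
Unset Strict Implicit.
Unset Printing Implicit Defensive.
Import Order.TTheory GRing.Theory Num.Theory.
Import numFieldNormedType.Exports.
Local Open Scope classical_set_scope.
Local Open Scope ring_scope.

Definition domain (R : realType) (Omega : set (R * R)) : Prop :=
  open Omega /\ connected Omega.

(* The functions are total on [R]; only their germs at the points of the
   (open) set [I] matter. *)
Definition Ck_on (R : realType) (k : nat) (I : set R) (f : R -> R) : Prop :=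
  (forall j : nat, (j < k)%N ->
     forall x : R, I x -> derivable (derive1n j f) x 1) /\
  (forall x : R, I x -> {for x, continuous (derive1n k f)}).

(* z_2 f_1''(z_1) + f_2'(z_1), minus the Jacobian determinant with respect to
   the labels z of the flow
     phi(z, t) = (t z_1 + z_2, z_2 f_1'(z_1) + f_2(z_1) + t f_1(z_1)). *)
Definition denom (R : realType) (f1 f2 : R -> R) (z : R * R) : R :=
  z.2 * derive1n 2 f1 z.1 + derive1 f2 z.1.

(* The conditions under which phi is C^1 and nondegenerate over [Omega]. *)
Definition admissible (R : realType) (Omega : set (R * R)) (f1 f2 : R -> R)
  : Prop :=
  [/\ Ck_on 2 (fst @` Omega) f1,
      Ck_on 1 (fst @` Omega) f2 &
      forall z : R * R, Omega z -> denom f1 f2 z != 0].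

(* This is the expression as stated in the source; the curl of the velocity of
   phi in these labels works out to - (1 + f1'^2) / denom instead. *)
Definition vorticity (R : realType) (f1 f2 : R -> R) (z : R * R) : R :=
  (derive1 f1 z.1) ^+ 2 / denom f1 f2 z.

(* Main.v *)
(** Forwards, divide numerator and denominator by [f1'^2]:
    [g1 = f2' / f1'^2] and [g2 = f1'' / f1'^2].  Backwards, these relations are
    solved in turn: [u = f1'] satisfies the Riccati equation [u' = g2 u^2], which
    has a nonvanishing solution on the whole of the compact segment [[a, b]], and
    then [f1] and [f2] are antiderivatives of [u] and [g1 u^2]. *)
Require Import Defs.
From HB Require Import structures.
From mathcomp Require Import all_boot all_order all_algebra.
From mathcomp Require Import ring.
From mathcomp Require Import all_classical all_reals all_analysis.
Set Implicit Arguments.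
Unset Strict Implicit.
Unset Printing Implicit Defensive.
Import Order.TTheory GRing.Theory Num.Theory.
Import numFieldNormedType.Exports.
Local Open Scope classical_set_scope.
Local Open Scope ring_scope.

(** First fundamental theorem of calculus for the integral from [a]. Continuity of [F] up to both
    endpoints is recorded because the Riccati lemma maximises [F] over the compact segment. *)
Lemma exists_antiderivative (R : realType) (f : R -> R) (a b : R) : a < b ->
  {within `[a, b], continuous f} ->
  exists F : R -> R, {within `[a, b], continuous F} /\
    {in `]a, b[, forall x : R, is_derive x 1 F (f x)}.
Proof.
move=> ab cf.
have intf : lebesgue_measure.-integrable `[a, b] (EFin \o f).
  by apply: continuous_compact_integrable => //; exact: segment_compact.
exists (fun x => \int[lebesgue_measure]_(t in `[a, x]) f t); split.
  exact: parameterized_integral_continuous (ltW ab) intf.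
move=> x xab; have /andP[ax xb] : a < x < b by rewrite in_itv in xab.
have [dF FE] := continuous_FTC1_closed xb intf ax
  (within_continuous_continuous ab cf xab).
by apply: DeriveDef => //; rewrite -derive1E.
Qed.

(* Separation of variables: [u = 1 / (c - G)] with [G' = g], where the constant
   [c] exceeds [max G] so that no blow-up occurs on the segment. *)
Lemma exists_riccati_solution (R : realType) (g : R -> R) (a b : R) : a < b ->
  {within `[a, b], continuous g} ->
  exists u : R -> R, [/\ {within `[a, b], continuous u},
    {in `[a, b], forall x, u x != 0} &
    {in `]a, b[, forall x : R, is_derive x 1 u (g x * u x ^+ 2)}].
Proof.
move=> ab /(exists_antiderivative ab)[G [cG dG]].
have [m _ Gm] := EVT_max (ltW ab) cG.
pose w x := G m + 1 - G x.
have w_neq0 x : x \in `[a, b] -> w x != 0.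
  by move=> /Gm Gx; rewrite gt_eqF// subr_gt0 (le_lt_trans Gx)// ltrDl.
exists (fun x => (w x)^-1); split => [|x xab|x xab].
- apply: (@within_continuous_comp _ _ _ _ w (fun y : R => y^-1)).
    by move=> _ /set_mem[x xab <-]; apply: inv_continuous; exact: w_neq0.
  by apply: within_continuousB cG; apply: continuous_subspaceT => x; exact: cvg_cst.
- by rewrite invr_neq0// w_neq0.
- have wx0 : w x != 0 by apply: w_neq0; exact: subset_itv_oo_cc.
  have dw : is_derive x 1 w (- g x).
    rewrite -[- g x]sub0r.
    exact: is_deriveB (is_derive_cst (G m + 1) x 1) (dG _ xab).
  apply: is_derive_eq (is_deriveV wx0 dw) _.
  by rewrite exprVn scalerN scaleNr opprK mulrC.
Qed.

Lemma within_continuousM (K : numFieldType) (T : topologicalType) (A : set T)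
    (f g : T -> K) :
  {within A, continuous f} -> {within A, continuous g} ->
  {within A, continuous (fun x => f x * g x)}.
Proof. by move=> cf cg x; exact: continuousM (cf x) (cg x). Qed.

Lemma derive1_in_oo (R : realType) (F f : R -> R) (a b : R) :
  {in `]a, b[, forall x : R, is_derive x 1 F (f x)} -> {in `]a, b[, derive1 F =1 f}.
Proof. by move=> dF x /dF dFx; rewrite derive1E derive_val. Qed.

(** Continuity at an interior point is local, and [h] agrees with [k] near it. Meant for [h] a
    derivative, whose formula [k] is known only on the open interval. *)
Lemma within_continuous_eq_in_oo (R : realType) (h k : R -> R) (a b x : R) :
  a < b -> {within `[a, b], continuous k} -> {in `]a, b[, h =1 k} ->
  x \in `]a, b[ -> {for x, continuous h}.
Proof.
move=> ab ck hk xab; rewrite /prop_for /continuous_at (hk _ xab).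
apply: cvg_trans (within_continuous_continuous ab ck xab); apply: near_eq_cvg.
by near=> y; apply/esym/hk; near: y; exact: near_in_itvoo.
Unshelve. all: by end_near. Qed.

Theorem lemma6p3 (R : realType) (Omega : set (R * R)) (hOmega : domain Omega) :
  (* every such vorticity has the second form, wherever f1' <> 0
     (elsewhere zeta = 0, which is not the inverse of anything) *)
  (forall (f1 f2 : R -> R) (zeta : R * R -> R),
     admissible Omega f1 f2 ->
     (forall z : R * R, Omega z -> zeta z = vorticity f1 f2 z) ->
     exists g1 g2 : R -> R,
       [/\ Ck_on 0 (fst @` Omega `&` [set x | derive1 f1 x != 0]) g1,
           Ck_on 0 (fst @` Omega `&` [set x | derive1 f1 x != 0]) g2 &
           forall z : R * R, Omega z -> derive1 f1 z.1 != 0 ->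
             g1 z.1 + z.2 * g2 z.1 != 0 /\
             zeta z = 1 / (g1 z.1 + z.2 * g2 z.1)]) /\
  (* g1 and g2 are arbitrary: over every strip a < z_1 < b with a and b in the
     projection of Omega, each such expression is a vorticity *)
  (forall g1 g2 : R -> R,
     Ck_on 0 (fst @` Omega) g1 ->
     Ck_on 0 (fst @` Omega) g2 ->
     (forall z : R * R, Omega z -> g1 z.1 + z.2 * g2 z.1 != 0) ->
     forall a b : R, (fst @` Omega) a -> (fst @` Omega) b -> a < b ->
     exists f1 f2 : R -> R,
       admissible (Omega `&` [set z | a < z.1 < b]) f1 f2 /\
       forall z : R * R, Omega z -> a < z.1 < b ->
         vorticity f1 f2 z = 1 / (g1 z.1 + z.2 * g2 z.1)).
Proof.
split=> [f1 f2 zeta [[d1 c1] [_ c2] den0] zetaE|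
         g1 g2 [_ c1] [_ c2] g_neq0 a b Ia Ib ab].
  pose u := derive1 f1; pose quot (h : R -> R) x := h x / u x ^+ 2.
  have quot_C0 h : (forall x, (fst @` Omega) x -> {for x, continuous h}) ->
      Ck_on 0 (fst @` Omega `&` [set x | u x != 0]) (quot h).
    move=> ch; split=> // x [Ix ux0]; rewrite derive1n0.
    (* The case [j = 1] of the C^2 hypothesis: f1' is derivable at [x], hence continuous there. *)
    have cu : {for x, continuous u}.
      apply: differentiable_continuous; apply/derivable1_diffP.
      exact: (d1 1%N).
    apply: continuousM; first exact: ch.
    apply: continuousV; first by rewrite expf_neq0.
    exact: (continuousM cu cu).
  exists (quot (derive1 f2)), (quot (derive1n 2 f1)).
  split; [exact: (quot_C0 (derive1 f2) c2) | exact: quot_C0 c1 |]; move=> z Oz u0.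
  have gE : quot (derive1 f2) z.1 + z.2 * quot (derive1n 2 f1) z.1
          = denom f1 f2 z / u z.1 ^+ 2.
    by rewrite /quot mulrA -mulrDl addrC.
  have den_z0 := den0 z Oz.
  split; first by rewrite gE mulf_neq0// invr_neq0// expf_neq0.
  by rewrite zetaE// gE div1r invf_div.
(* The projection of a connected set is an interval, so it contains the whole compact segment
   between [a] and [b], on which [g1] and [g2] are then continuous. *)
have itvI : connected (fst @` Omega).
  apply: connected_continuous_connected hOmega.2 _.
  by apply: continuous_subspaceT => z; exact: cvg_fst.
have {}itvI : `[a, b] `<=` fst @` Omega.
  move=> x /=; rewrite in_itv => xab.
  exact: (connected_intervalP _).1 itvI a b Ia Ib x xab.
have within_cont (g : R -> R) :
    (forall x, (fst @` Omega) x -> {for x, continuous (derive1n 0 g)}) ->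
    {within `[a, b], continuous g}.
  move=> cg; apply: continuous_in_subspaceT => x /set_mem xab.
  exact/cg/itvI.
have [u [cu u0 du]] := exists_riccati_solution ab (within_cont _ c2).
have [f1 [cf1 df1]] := exists_antiderivative ab cu.
have cu2 : {within `[a, b], continuous (fun x => u x ^+ 2)}.
  exact: (within_continuousM cu cu).
have cgu2 (g : R -> R) : {within `[a, b], continuous g} ->
    {within `[a, b], continuous (fun x => g x * u x ^+ 2)}.
  by move=> cg; exact: within_continuousM cg cu2.
have cg1u2 := cgu2 _ (within_cont _ c1).
have cg2u2 := cgu2 _ (within_cont _ c2).
have [f2 [cf2 df2]] := exists_antiderivative ab cg1u2.
have f1E := derive1_in_oo df1.
(* [derive1 f1] is known to equal [u] only inside the open interval; agreement near [x] is enough to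
   transfer the derivative. *)
have ddf1 : {in `]a, b[, forall x : R, is_derive x 1 (derive1 f1) (g2 x * u x ^+ 2)}.
  move=> x xab; apply: near_eq_is_derive (du _ xab).
  by near=> y; apply/esym/f1E; near: y; exact: near_in_itvoo.
have f1EE := derive1_in_oo ddf1.
have f2E := derive1_in_oo df2.
(* Since f1'' = g2 u^2 and f2' = g1 u^2, the denominator has the factor u^2 = f1'^2, which cancels
   the numerator of the vorticity. *)
have denE z : a < z.1 < b ->
    denom f1 f2 z = u z.1 ^+ 2 * (g1 z.1 + z.2 * g2 z.1).
  move=> zab; rewrite /denom derive1nS derive1n1 f1EE ?f2E ?in_itv//.
  by ring.
have strip x : (fst @` (Omega `&` [set z | a < z.1 < b])) x -> x \in `]a, b[.
  by move=> [z [_ zab] <-]; rewrite in_itv.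
have u_neq0 x : x \in `]a, b[ -> u x ^+ 2 != 0.
  by move=> xab; rewrite expf_neq0// u0// subset_itv_oo_cc.
exists f1, f2; split; [split|].
(* Orders 0 and 1 of derivability for [f1], then continuity of f1'' through its formula g2 u^2. *)
- split=> [[|[|//]] _ x /strip xab|x /strip xab] /=.
  + by have := df1 _ xab.
  + by have := ddf1 _ xab.
  + exact: within_continuous_eq_in_oo ab cg2u2 f1EE xab.
- split=> [[|//] _ x /strip xab|x /strip xab].
  + by have := df2 _ xab.
  + exact: within_continuous_eq_in_oo ab cg1u2 f2E xab.
- move=> z [Oz zab]; rewrite denE// mulf_neq0 ?g_neq0//.
  by apply: u_neq0; rewrite in_itv.
- move=> z Oz zab; rewrite /vorticity denE// f1E ?in_itv//.
  have uz : u z.1 ^+ 2 != 0 by apply: u_neq0; rewrite in_itv.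
  by rewrite invfM mulrA divff.
Unshelve. all: by end_near. Qed.
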